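(* Let $A$ be a commutative ring with unit, $M$ a free $A$-module of rank $r$, and $f\in\mathrm{End}_A(M)$. Let $\mathbf f(t)=\sum_{k\ge0}f_kt^k:\bigwedge M\to(\bigwedge M)[[t]]$, $E_r(t)\in A[t]$ and $\mathtt U_i(\mathbf f)\in\mathrm{End}_A(\bigwedge M)$ be as in the context. Then \[ \mathbf f(t)=\frac{\mathtt U_0(\mathbf f)+\mathtt U_1(\mathbf f)t+\ldots+\mathtt U_{r-1}(\mathbf f)t^{r-1}}{E_r(t)} . \] Moreover, for each $j=1,\ldots,r$ and every $\alpha\in\bigwedge^{r-j+1}M$, \[ \mathbf f(t)(\alpha)=\frac{\mathtt U_0(\mathbf f)(\alpha)+\mathtt U_1(\mathbf f)(\alpha)t+\ldots+\mathtt U_{j-1}(\mathbf f)(\alpha)t^{j-1}}{E_r(t)} . \]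
   Context: $\bigwedge M=\bigoplus_{j=0}^r\bigwedge^jM$ is the exterior algebra of $M$ over $A$ (with $\bigwedge^0M=A$, $\bigwedge^1M=M$). The wedge product is extended to $(\bigwedge M)[[t]]$ by $(\sum_i\alpha_it^i)\wedge(\sum_j\beta_jt^j)=\sum_{i,j}(\alpha_i\wedge\beta_j)t^{i+j}$. To $f\in\mathrm{End}_A(M)$ one associates the unique $A$-module homomorphism $\mathbf f(t)=\sum_{k\ge 0}f_kt^k:\bigwedge M\to(\bigwedge M)[[t]]$, with $f_k\in\mathrm{End}_A(\bigwedge M)$, such that $\mathbf f(t)(\alpha\wedge\beta)=\mathbf f(t)\alpha\wedge\mathbf f(t)\beta$ for all $\alpha,\beta\in\bigwedge M$, and such that the restriction of $\mathbf f(t)$ to $M$ is $\mathrm{id}_M+\sum_{k\ge 1}f^kt^k$, where $f^k$ is the $k$-th iterate of $f$. Write $\det(t\,\mathrm{id}_M-f)=t^r-e_1t^{r-1}+\ldots+(-1)^re_r$ and $E_r(t)=\det(\mathrm{id}_M-ft)=1-e_1t+\ldots+(-1)^re_rt^r$, which is invertible in $A[[t]]$; division by $E_r(t)$ means multiplication by its inverse in $A[[t]]$. For each $i\ge 0$, $\mathtt U_i(\mathbf f)=f_i-e_1f_{i-1}+\ldots+(-1)^re_rf_{i-r}\in\mathrm{End}_A(\bigwedge M)$, with the convention that $f_k=0$ if $k<0$. The first equality is an identity of formal power series with coefficients in $\mathrm{End}_A(\bigwedge M)$, the second an identity in $(\bigwedge M)[[t]]$.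
   Formalization: The first identity is stated only on the sum of the exterior powers of degrees 1 to r; in degree 0 it fails unless e_r = 0 (for M = A, f = id, f(t)(1) = 1 but the right side is 1/(1-t)). *)

(* Defs.v *)
From HB Require Import structures.
From mathcomp Require Import all_boot all_order all_algebra.

Set Implicit Arguments.
Unset Strict Implicit.
Unset Printing Implicit Defensive.

Import GRing.Theory VectorInternalTheory.
Local Open Scope ring_scope.

(* A formal power series with coefficients in V is the sequence of its
   coefficients. *)
Definition fps (V : Type) := nat -> V.

Definition fps_mul (R : nzRingType) (a b : fps R) : fps R :=
  fun n => \sum_(i < n.+1) a i * b (n - i)%N.

Definition fps_scale (A : nzRingType) (V : lmodType A) (a : fps A) (v : fps V) :
    fps V :=
  fun n => \sum_(i < n.+1) a i *: v (n - i)%N.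

(* Inverse in A[[t]] of a polynomial p with constant term 1: the geometric
   series of 1 - p, in which only the powers of exponent at most n contribute
   to the coefficient of t^n. *)
Definition fps_inv (A : nzRingType) (p : {poly A}) : fps A :=
  fun n => \sum_(k < n.+1) ((1 - p) ^+ k)`_n.

Lemma coef_exp_lt (A : comNzRingType) (q : {poly A}) (k n : nat) :
  q`_0 = 0 -> (n < k)%N -> (q ^+ k)`_n = 0.
Proof.
move=> q0; elim: k n => [//|k IHk] n lt_n_k.
rewrite exprS coefM big1 // => i _.
have [i0|i_gt0] := posnP i; first by rewrite i0 q0 mul0r.
rewrite IHk ?mulr0 //; case: n i lt_n_k i_gt0 => [|n] [[|i] lt_i] //= lt_n_k _.
by rewrite subSS (leq_ltn_trans (leq_subr _ _)).
Qed.

Lemma fps_mul_inv (A : comNzRingType) (p : {poly A}) :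
  p`_0 = 1 -> forall n, fps_mul (fun i => p`_i) (fps_inv p) n = (n == 0)%:R.
Proof.
move=> p0 n; set q := 1 - p.
have q0 : q`_0 = 0 by rewrite coefB coef1 p0 subrr.
have invE m : (m <= n)%N -> fps_inv p m = (\sum_(k < n.+1) q ^+ k)`_m.
  move=> le_mn; rewrite coef_sum /fps_inv.
  rewrite [RHS](bigID (fun k : 'I_n.+1 => (k < m.+1)%N)) /= [X in _ = _ + X]big1 ?addr0.
    by rewrite (big_ord_widen n.+1 (fun k => ((1 - p) ^+ k)`_m)).
  by move=> k; rewrite -leqNgt => lt_mk; rewrite coef_exp_lt.
have -> : fps_mul (fun i => p`_i) (fps_inv p) n = (p * \sum_(k < n.+1) q ^+ k)`_n.
  by rewrite coefM; apply: eq_bigr => i _; rewrite invE ?leq_subr.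
have -> : p * \sum_(k < n.+1) q ^+ k = 1 - q ^+ n.+1.
  by rewrite -[RHS]opprB subrX1 -mulNr opprB subKr.
by rewrite coefB coef1 coef_exp_lt // subr0.
Qed.

Section ExteriorAlgebra.

Variables (A : comNzRingType) (M : vectType A) (L : algType A).
Variable iota : {linear M -> L}.

(* (L, iota) is an exterior algebra of M: iota is universal among the linear
   maps from M to an associative unital A-algebra whose values square to 0.
   The wedge product is the multiplication of L, and M embeds in L by iota. *)
Definition exterior_algebra : Prop :=
  (forall m, iota m * iota m = 0) /\
  forall (B : algType A) (g : {linear M -> B}),
    (forall m, g m * g m = 0) ->
    exists h : {lrmorphism L -> B},
      (forall m, h (iota m) = g m) /\
      (forall h' : {lrmorphism L -> B},
         (forall m, h' (iota m) = g m) -> h' =1 h).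

(* The A-submodule \bigwedge^j M spanned by the products of j vectors; for
   j = 0 it is A 1. *)
Definition ext_power (j : nat) (alpha : L) : Prop :=
  exists (n : nat) (c : 'I_n -> A) (m : 'I_n -> 'I_j -> M),
    alpha = \sum_(i < n) c i *: \prod_(k < j) iota (m i k).

(* \bigwedge^1 M (+) ... (+) \bigwedge^r M, where r is the rank of M.  Degree 0
   is left out: f(t)(1) = 1, whereas E_r(t) = U_0(f)(1) + ... + U_r(f)(1) t^r
   with U_r(f)(1) = (-1)^r e_r, so that f(t) = (U_0(f) + ... +
   U_(r-1)(f) t^(r-1)) / E_r(t) fails at 1 unless e_r = 0. *)
Definition ext_positive (alpha : L) : Prop :=
  exists2 a : nat -> L, forall j, ext_power j (a j)
    & alpha = \sum_(1 <= j < (dim M).+1) a j.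

(* f(t) = \sum_k F k t^k is multiplicative and restricts to
   id_M + \sum_(k >= 1) f^k t^k on M. *)
Definition ext_extension (f : 'End(M)) (F : fps {linear L -> L}) : Prop :=
  (forall alpha beta, (fun k => F k (alpha * beta)) =1
     fps_mul (fun k => F k alpha) (fun k => F k beta)) /\
  (forall k m, F k (iota m) = iota (iter k f m)).

End ExteriorAlgebra.

Section Determinants.

Variables (A : comNzRingType) (M : vectType A) (f : 'End(M)).

(* f2mx f is the matrix of f in the distinguished basis of M (acting on row
   vectors).  det(t id - f) = t^r - e_1 t^(r-1) + ... + (-1)^r e_r; only the
   indices i <= r are meaningful. *)
Definition char_coef (i : nat) : A :=
  (-1) ^+ i * (char_poly (f2mx f))`_(dim M - i).

(* E_r(t) = det(id - f t) *)
Definition Epoly : {poly A} :=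
  \det (1%:M - 'X *: map_mx (@polyC A) (f2mx f)).

Lemma Epoly_coef0 : Epoly`_0 = 1.
Proof.
rewrite -horner_coef0 -[_.[0]]/(horner_eval 0 Epoly) -det_map_mx.
rewrite -[RHS](det1 A (dim M)); congr (\det _); apply/matrixP => i j.
by rewrite !mxE rmorphB rmorphM rmorph_nat [X in _ - X * _]hornerX mul0r subr0.
Qed.

Lemma Epoly_inv n :
  fps_mul (fun i => Epoly`_i) (fps_inv Epoly) n = (n == 0)%:R.
Proof. exact/fps_mul_inv/Epoly_coef0. Qed.

(* U_i(f) = f_i - e_1 f_(i-1) + ... + (-1)^r e_r f_(i-r), the f_k with k < 0
   being 0. *)
Definition Uop (L : algType A) (F : fps {linear L -> L}) (i : nat) (alpha : L) :
    L :=
  \sum_(k < (dim M).+1 | (k <= i)%N)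
     ((-1) ^+ k * char_coef k) *: F (i - k)%N alpha.

(* (U_0(f)(alpha) + U_1(f)(alpha) t + ... + U_(n-1)(f)(alpha) t^(n-1)) / E_r(t) *)
Definition Uquotient (L : algType A) (F : fps {linear L -> L}) (n : nat)
    (alpha : L) : fps L :=
  fps_scale (fps_inv Epoly) (fun i => if (i < n)%N then Uop F i alpha else 0).

End Determinants.

(* Main.v *)
(** Fix a basis e_1, ..., e_n of M and put B = id - tf, so that E = det B and
    f(t) restricted to M is B^-1 = adj(B) / E.  For a wedge product of p >= 1
    basis vectors, E^p f(t)(e_(s 1) /\ ... /\ e_(s p)) is the wedge product of
    rows of adj(B), and its coordinates are p x p minors of adj(B).  By Jacobi,
    E times such a minor is, up to sign, E^p times the complementary
    (n-p) x (n-p) minor of B, which has degree at most n - p in t.  Cancelling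
    E^p, the series E f(t)(alpha), whose coefficients are the U_i(f)(alpha), is
    a polynomial of degree at most n - p for every alpha in the p-th exterior
    power. *)
Require Import Defs.
From HB Require Import structures.
From mathcomp Require Import all_boot all_order all_algebra perm.

Set Implicit Arguments.
Unset Strict Implicit.
Unset Printing Implicit Defensive.

Import GRing.Theory VectorInternalTheory.
Local Open Scope ring_scope.

(** * Minors of the adjugate matrix *)

(** Any p distinct rows or columns can thus be permuted into leading position, so that the minor
    they define becomes a corner block. *)
Lemma inj_perm_extend (p q : nat) (s : 'I_p -> 'I_(p + q)) :
  injective s -> exists u : 'S_(p + q), forall k, u (lshift q k) = s k.
Proof.
move=> inj_s; pose S := ~: [set s k | k : 'I_p].
have cardS : #|S| = q by rewrite cardsCs setCK card_ord card_imset // card_ord addKn.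
pose t (l : 'I_q) : 'I_(p + q) := enum_val (cast_ord (esym cardS) l).
have tS l : t l \in S := enum_valP _.
have st k l : s k != t l.
  by apply: contraTneq (tS l) => <-; rewrite inE negbK imset_f.
pose h i := match split i with inl k => s k | inr l => t l end.
have inj_h : injective h.
  move=> i j; rewrite /h -[i]splitK -[j]splitK !unsplitK.
  case: (split i) (split j) => [k|l] [k'|l'] /= eq_h.
  - by rewrite (inj_s _ _ eq_h).
  - by case/eqP: (st k l').
  - by case/eqP: (st k' l).
  - by rewrite (cast_ord_inj (enum_val_inj eq_h)).
exists (perm inj_h) => k; rewrite permE /h.
by rewrite -[lshift q k]/(unsplit (inl k)) unsplitK.
Qed.

Lemma det_mxsub_perm (R : comNzRingType) n (u v : 'S_n) (B : 'M[R]_n) :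
  \det (mxsub u v B) = (-1) ^+ (u (+) v) * \det B.
Proof.
have ->: mxsub u v B = row_perm u (col_perm v B) by apply/matrixP => i j; rewrite !mxE.
rewrite row_permE col_permE !det_mulmx !det_perm odd_permV signr_addb.
by rewrite -!mulrA; congr (_ * _); rewrite mulrC.
Qed.

(* Jacobi's complementary minor theorem. *)
Lemma det_mxsub_adj (R : comNzRingType) p q (B : 'M[R]_(p + q))
    (s g : 'I_p -> 'I_(p + q)) : injective s -> injective g ->
  exists (b : bool) (s' g' : 'I_q -> 'I_(p + q)),
    \det (mxsub s g (\adj B)) * \det B
    = \det B ^+ p * ((-1) ^+ b * \det (mxsub g' s' B)).
Proof.
move=> /inj_perm_extend[u us] /inj_perm_extend[v vg].
exists (v (+) u), (u \o @rshift p q), (v \o @rshift p q).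
(* The roles of [u] and [v] are exchanged between [C'] and [B'], as the adjugate is transposed with
   respect to [B]; this keeps the product scalar. *)
pose C' := mxsub u v (\adj B); pose B' := mxsub v u B.
have CB : C' *m B' = (\det B)%:M.
  apply/matrixP => i j; rewrite !mxE.
  have /matrixP/(_ (u i) (u j)) := mul_adj_mx B.
  rewrite !mxE (inj_eq perm_inj) => <-; rewrite [RHS](reindex_inj (@perm_inj _ v)) /=.
  by apply: eq_bigr => k _; rewrite !mxE.
have -> : mxsub s g (\adj B) = ulsubmx C'.
  by apply/matrixP => i j; rewrite !mxE us vg.
have -> : mxsub (v \o @rshift p q) (u \o @rshift p q) B = drsubmx B'.
  by apply/matrixP => i j; rewrite !mxE.
(* With its lower rows replaced by [(0, 1)], [C'] has the given minor as determinant, while the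
   product with [B'] is block triangular and exhibits the complementary minor. *)
have : block_mx (ulsubmx C') (ursubmx C') 0 1%:M *m B'
       = block_mx (\det B)%:M 0 (dlsubmx B') (drsubmx B').
  rewrite -{1}[B']submxK mulmx_block !mul0mx !mul1mx !add0r.
  move: CB; rewrite -{1}[C']submxK -{1}[B']submxK mulmx_block scalar_mx_block.
  by case/eq_block_mx => -> -> _ _.
move/(congr1 determinant); rewrite det_mulmx det_ublock det_lblock det1 mulr1.
rewrite det_scalar det_mxsub_perm mulrCA => /(congr1 ( *%R ((-1) ^+ (v (+) u)))).
by rewrite signrMK => ->; rewrite mulrCA.
Qed.

Lemma size_linear_poly (R : nzRingType) (a b : R) : (size (a%:P + b *: 'X)%R <= 2)%N.
Proof.
apply: leq_trans (size_polyD _ _) _; rewrite geq_max.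
by rewrite (leq_trans (size_polyC_leq1 _)) // (leq_trans (size_scale_leq _ _)) ?size_polyX.
Qed.

Lemma size_prod_linear (R : comNzRingType) I (r : seq I) (F : I -> {poly R}) :
  (forall i, (size (F i) <= 2)%N) -> (size (\prod_(i <- r) F i)%R <= (size r).+1)%N.
Proof.
move=> sF; elim: r => [|i r IHr]; first by rewrite big_nil size_poly1.
rewrite big_cons; apply: leq_trans (size_polyMleq _ _) _.
have := leq_add (sF i) IHr; rewrite /= add2n.
by case: (_ + _)%N.
Qed.

Lemma size_det_linear (R : comNzRingType) n (B : 'M[{poly R}]_n) :
  (forall i j, (size (B i j) <= 2)%N) -> (size (\det B) <= n.+1)%N.
Proof.
move=> sB; apply: (leq_trans (size_sum _ _ _)); apply/bigmax_leqP => u _.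
rewrite size_Msign.
have := @size_prod_linear R _ (enum 'I_n) _ (fun i => sB i (u i)).
by rewrite size_enum_ord big_enum.
Qed.

(** A repeated row or column kills the minor, and [Q = 0] works. Otherwise p <= n, and Jacobi's
    theorem gives for [Q] a signed minor of [B] of order n - p. *)
Lemma det_mxsub_adj_linear (R : comNzRingType) n p (B : 'M[{poly R}]_n)
    (s g : 'I_p -> 'I_n) :
  (forall i j, (size (B i j) <= 2)%N) ->
  exists2 Q : {poly R}, (size Q <= (n - p).+1)%N
    & \det (mxsub s g (\adj B)) * \det B = \det B ^+ p * Q.
Proof.
move=> sB.
have det0 : ~~ injectiveb s \/ ~~ injectiveb g -> \det (mxsub s g (\adj B)) = 0.
  case=> /injectivePn[i [j ne_ij eq_ij]].
    by apply: (determinant_alternate ne_ij) => k; rewrite !mxE eq_ij.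
  rewrite -det_tr; apply: (determinant_alternate ne_ij) => k.
  by rewrite !mxE eq_ij.
have [/injectiveP inj_s|] := boolP (injectiveb s); last first.
  by move=> ns; exists 0; rewrite ?size_poly0 // det0 ?mul0r ?mulr0 //; left.
have [/injectiveP inj_g|] := boolP (injectiveb g); last first.
  by move=> ns; exists 0; rewrite ?size_poly0 // det0 ?mul0r ?mulr0 //; right.
have le_pn : (p <= n)%N by have := leq_card s inj_s; rewrite !card_ord.
have def_n := subnKC le_pn; move: (n - p)%N def_n => q def_n.
case: n / def_n B s g sB {det0 le_pn} inj_s inj_g => B s g sB inj_s inj_g.
have [b [s' [g' ->]]] := det_mxsub_adj B inj_s inj_g.
eexists; last by [].
rewrite size_Msign; apply: size_det_linear => i j; rewrite mxE; exact: sB.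
Qed.

(* The entries are reversed in degree 1, hence the determinant in degree [n]. *)
Lemma det_reversal (R : comNzRingType) n (B B' : 'M[{poly R}]_n) :
  (forall i j, exists a b, B i j = a%:P + b *: 'X /\ B' i j = b%:P + a *: 'X) ->
  forall k, (k <= n)%N -> (\det B)`_k = (\det B')`_(n - k).
Proof.
move=> BB' k le_kn; rewrite /determinant !coef_sum; apply: eq_bigr => u _.
suff rev : (\prod_i B i (u i))`_k = (\prod_i B' i (u i))`_(n - k).
  by rewrite !mulr_sign; case: (odd_perm u); rewrite ?coefN rev.
have rev (r : seq 'I_n) m : (m <= size r)%N ->
    (\prod_(i <- r) B i (u i))`_m = (\prod_(i <- r) B' i (u i))`_(size r - m).
  elim: r m => [|i r IHr] m; first by rewrite !big_nil leqn0 => /eqP->.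
  have [a [b [Bi B'i]]] := BB' i (u i).
  have sz (D : 'M[{poly R}]_n) : (forall i j, (size (D i j) <= 2)%N) ->
      (\prod_(i <- r) D i (u i))`_(size r).+1 = 0.
    by move=> sD; apply: nth_default; apply: size_prod_linear.
  have Bsz : (\prod_(i <- r) B i (u i))`_(size r).+1 = 0.
    by apply: sz => i' j'; have [c [d [-> _]]] := BB' i' j'; apply: size_linear_poly.
  have B'sz : (\prod_(i <- r) B' i (u i))`_(size r).+1 = 0.
    by apply: sz => i' j'; have [c [d [_ ->]]] := BB' i' j'; apply: size_linear_poly.
  rewrite !big_cons Bi B'i !mulrDl -!scalerAl !coefD !coefCM !coefZ !coefXM /=.
  (* At both ends of the range one summand vanishes on each side: a coefficient beyond the degree is
     matched with the constant coefficient of a multiple of ['X]. *)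
  case: m => [_|m le_m].
    by rewrite subn0 /= B'sz !mulr0 addr0 add0r IHr // subn0.
  rewrite ltnS in le_m; rewrite subSS (IHr m) //.
  have [le_r|lt_r] := leqP (size r) m.
    have -> : m = size r by apply/eqP; rewrite eqn_leq le_m.
    by rewrite Bsz mulr0 subnn mulr0 add0r addr0.
  by rewrite IHr // addrC subnS subn_eq0 leqNgt lt_r.
by have := rev (enum 'I_n) k; rewrite size_enum_ord !big_enum; apply.
Qed.

(** * Alternating products *)

Section AnticommutingFamily.

Variables (L : nzRingType) (T : Type) (x : T -> L).
Hypothesis sqr_x : forall t, x t * x t = 0.
Hypothesis anti_x : forall t u, x t * x u = - (x u * x t).

Lemma anticomm_prod t (s : seq T) :
  x t * \prod_(u <- s) x u = (-1) ^+ size s * ((\prod_(u <- s) x u) * x t).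
Proof.
elim: s => [|u s IHs]; first by rewrite big_nil !mul1r mulr1.
rewrite big_cons mulrA anti_x mulNr -[X in - X]mulrA IHs exprS mulN1r mulNr; congr (- _).
by rewrite !mulrA commr_sign.
Qed.

(** Carrying either outer factor across [s] costs the same sign, so everything reduces to exchanging
    two adjacent factors. *)
Lemma anticomm_prod_swap t u (s : seq T) :
  x t * (\prod_(v <- s) x v) * x u = - (x u * (\prod_(v <- s) x v) * x t).
Proof.
rewrite !anticomm_prod -[in LHS]mulrA -[in LHS]mulrA anti_x.
by rewrite mulrN mulrN !mulrA.
Qed.

Lemma anticomm_prod_sqr t (s : seq T) : x t * (\prod_(v <- s) x v) * x t = 0.
Proof. by rewrite anticomm_prod -!mulrA sqr_x !mulr0. Qed.

End AnticommutingFamily.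

(** Products in [L] do not commute and follow the order of [index_enum I], so the two factors to be
    exchanged must be located there. *)
Lemma split_index_enum (I : finType) (i j : I) : i != j ->
  exists s1 s2 s3, index_enum I = s1 ++ i :: s2 ++ j :: s3
    \/ index_enum I = s1 ++ j :: s2 ++ i :: s3.
Proof.
move=> ne_ij; have := mem_index_enum j.
case/splitPr: (mem_index_enum i) => [p1 p2].
rewrite mem_cat inE eq_sym (negPf ne_ij) /=.
case/orP => /splitPr[q1 q2].
  by exists q1, q2, p2; right; rewrite -catA.
by exists p1, q1, q2; left.
Qed.

Section AlternatingProduct.

Variables (L : nzRingType) (T : Type) (x : T -> L).
Hypothesis sqr_x : forall t, x t * x t = 0.
Hypothesis anti_x : forall t u, x t * x u = - (x u * x t).
Variable I : finType.

Lemma alternating_prod_tperm (h : I -> T) (i j : I) : i != j ->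
  \prod_k x (h (tperm i j k)) = - \prod_k x (h k).
Proof.
move=> ne_ij.
wlog [s1 [s2 [s3 def_e]]] : i j ne_ij /
    exists s1 s2 s3, index_enum I = s1 ++ i :: s2 ++ j :: s3.
  move=> IH; have [s1 [s2 [s3 [def_e|def_e]]]] := split_index_enum ne_ij.
    by apply: IH => //; exists s1, s2, s3.
  by rewrite tpermC; apply: IH; [rewrite eq_sym | exists s1, s2, s3].
have fixed (s : seq I) : i \notin s -> j \notin s ->
    \prod_(k <- s) x (h (tperm i j k)) = \prod_(k <- s) x (h k).
  move=> i_s j_s; apply: eq_big_seq => k ks.
  by rewrite tpermD //; [apply: contraNneq i_s | apply: contraNneq j_s] => ->.
(* The enumeration has no duplicates, so [i] and [j] occur only at the two displayed places and the
   transposition fixes all other factors. *)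
have notin a : (a == i) (+) (a == j) -> [/\ a \notin s1, a \notin s2 & a \notin s3].
  move=> a_ij; have := count_uniq_mem a (index_enum_uniq I).
  rewrite mem_index_enum def_e count_cat /= count_cat /= !(eq_sym _ a).
  case: (a == i) (a == j) a_ij => [] [] //= _; rewrite !(add0n, add1n, addnS);
  by case=> /eqP; rewrite !addn_eq0 => /and3P[c1 c2 c3];
    split; apply/count_memPn/eqP.
have [i1 i2 i3] : [/\ i \notin s1, i \notin s2 & i \notin s3].
  by apply: notin; rewrite eqxx (negPf ne_ij).
have [j1 j2 j3] : [/\ j \notin s1, j \notin s2 & j \notin s3].
  by apply: notin; rewrite eqxx eq_sym (negPf ne_ij).
rewrite def_e !big_cat !big_cons !big_cat !big_cons /= !fixed // tpermL tpermR.
have := @anticomm_prod_swap L I (x \o h) (fun t u => anti_x (h t) (h u)) j i s2.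
by move=> /= swap; rewrite -mulrN; congr (_ * _); rewrite !mulrA swap !mulNr.
Qed.

(** Exchanging the equal factors would only show that twice the product is zero; the vanishing of
    squares also covers the case where 2 is a zero divisor. *)
Lemma alternating_prod_repeat (h : I -> T) (i j : I) : i != j -> h i = h j ->
  \prod_k x (h k) = 0.
Proof.
move=> /split_index_enum[s1 [s2 [s3 def_e]]] eq_h.
have zero := @anticomm_prod_sqr L I (x \o h) (fun t => sqr_x (h t))
  (fun t u => anti_x (h t) (h u)) i s2.
by case: def_e => ->; rewrite big_cat big_cons big_cat big_cons /= -?eq_h;
  rewrite [X in _ * X](_ : _ = 0) ?mulr0 // !mulrA zero mul0r.
Qed.

Lemma alternating_prod_perm (h : I -> T) (u : {perm I}) :
  \prod_k x (h (u k)) = (-1) ^+ u * \prod_k x (h k).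
Proof.
have [ts -> /allP dts] := prod_tpermP u.
elim: ts dts => [|t ts IHts] dts.
  by rewrite big_nil odd_perm1 mul1r; apply: eq_bigr => k _; rewrite perm1.
have dt : t.1 != t.2 := dts t (mem_head _ _).
rewrite big_cons odd_mul_tperm dt signr_addb -mulrA -IHts; last first.
  by move=> t' t'_ts; apply: dts; rewrite inE t'_ts orbT.
rewrite mulN1r -(alternating_prod_tperm (h \o (\prod_(t <- ts) tperm t.1 t.2)%g) dt).
by apply: eq_bigr => k _; rewrite permM.
Qed.

End AlternatingProduct.

Lemma central_prod (R : comNzRingType) (L : nzRingType) (K : {rmorphism R -> L})
    (central : forall a y, K a * y = y * K a) I (r : seq I) (a : I -> R) (y : I -> L) :
  \prod_(i <- r) (K (a i) * y i) = K (\prod_(i <- r) a i) * \prod_(i <- r) y i.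
Proof.
elim: r => [|i r IHr]; first by rewrite !big_nil rmorph1 mulr1.
rewrite !big_cons IHr rmorphM !mulrA; congr (_ * _).
by rewrite -!mulrA; congr (_ * _); rewrite central.
Qed.

Section AlternatingExpansion.

Variables (R : comNzRingType) (L : nzRingType) (K : {rmorphism R -> L}).
Hypothesis central : forall a y, K a * y = y * K a.
Variables (n p : nat) (x : 'I_n -> L).
Hypothesis sqr_x : forall i, x i * x i = 0.
Hypothesis anti_x : forall i j, x i * x j = - (x j * x i).

Let eqperm (g g' : {ffun 'I_p -> 'I_n}) :=
  [exists u : 'S_p, g' == [ffun k => g (u k)]].

Let eqperm_refl g : eqperm g g.
Proof. by apply/existsP; exists 1%g; apply/eqP/ffunP => k; rewrite ffunE perm1. Qed.

Let eqperm_sym g g' : eqperm g g' -> eqperm g' g.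
Proof.
case/existsP => u /eqP->; apply/existsP; exists u^-1%g.
by apply/eqP/ffunP => k; rewrite !ffunE permKV.
Qed.

Let eqperm_trans g1 g2 g3 : eqperm g1 g2 -> eqperm g2 g3 -> eqperm g1 g3.
Proof.
case/existsP => u /eqP-> /existsP[v /eqP->]; apply/existsP; exists (v * u)%g.
by apply/eqP/ffunP => k; rewrite !ffunE permM.
Qed.

(** A canonical element of the orbit of [g] under permutation of its arguments: equivalent functions
    define extensionally equal predicates, on which [choose] returns the same value. *)
Let repr (g : {ffun 'I_p -> 'I_n}) : {ffun 'I_p -> 'I_n} := choose (eqperm g) g.

Let repr_eqperm g : eqperm g (repr g).
Proof. exact: chooseP (eqperm_refl g). Qed.

Let eqperm_repr g g' : eqperm g g' -> repr g = repr g'.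
Proof.
move=> gg'; rewrite /repr (@choose_id _ (eqperm g) g g') //.
apply: eq_choose => h; apply/idP/idP; last exact: eqperm_trans.
exact/eqperm_trans/eqperm_sym.
Qed.

(* Only injective [g] contribute to the expansion; those which differ by a
   permutation of ['I_p] add up to a determinant. *)
Lemma alternating_expansion (C : 'M[R]_(p, n)) :
  exists s : seq {ffun 'I_p -> 'I_n},
    \prod_k \sum_i K (C k i) * x i
    = \sum_(g <- s) K (\det (colsub g C)) * \prod_k x (g k).
Proof.
exists (enum [pred g : {ffun 'I_p -> 'I_n} | injectiveb g & repr g == g]).
rewrite bigA_distr_bigA big_enum /=.
pose T (g : {ffun 'I_p -> 'I_n}) := K (\prod_k C k (g k)) * \prod_k x (g k).
(* A choice of indices with a repetition contributes zero. *)
have -> : \sum_(g : {ffun 'I_p -> 'I_n}) \prod_k (K (C k (g k)) * x (g k))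
          = \sum_(g : {ffun 'I_p -> 'I_n} | injectiveb g) T g.
  rewrite (bigID (fun g : {ffun 'I_p -> 'I_n} => injectiveb g)) /=.
  rewrite [X in _ + X]big1 ?addr0 => [|g /injectivePn[i [j ne_ij eq_g]]].
    by apply: eq_bigr => g _; apply: central_prod.
  rewrite central_prod //.
  by rewrite (alternating_prod_repeat sqr_x anti_x ne_ij eq_g) mulr0.
have inj_perm (g : {ffun 'I_p -> 'I_n}) (u : 'S_p) : injectiveb g -> injectiveb [ffun k => g (u k)].
  move=> /injectiveP inj_g; apply/injectiveP => k l; rewrite !ffunE => /inj_g.
  exact: perm_inj.
rewrite (partition_big repr [pred g : {ffun 'I_p -> 'I_n} | injectiveb g & repr g == g])
  /=; last first.
  move=> g inj_g; rewrite -(eqperm_repr (repr_eqperm g)) eqxx andbT.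
  by have /existsP[u /eqP->] := repr_eqperm g; apply: inj_perm.
apply: eq_bigr => g0 /andP[inj_g0 /eqP repr_g0].
pose act (u : 'S_p) := [ffun k => g0 (u k)].
have inj_act : injective act.
  move=> u v /ffunP eq_uv; apply/permP => k; have := eq_uv k.
  by rewrite !ffunE => /(injectiveP _ inj_g0).
(* The fibre of [repr] over [g0] is the orbit of [g0], parametrised without repetition by
   permutations since [g0] is injective; summing over it gives the Leibniz formula. *)
rewrite (eq_bigl (mem (act @: 'S_p))) => [|g]; last first.
  apply/andP/imsetP => [[_ /eqP repr_g]|[u _ ->]].
    have: eqperm g0 g by rewrite -repr_g; apply/eqperm_sym/repr_eqperm.
    by case/existsP => u /eqP ->; exists u.
  split; first exact: inj_perm.
  by rewrite -[X in _ == X]repr_g0 eq_sym; apply/eqP/eqperm_repr/existsP; exists u.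
rewrite big_imset /=; last by move=> u v _ _; apply: inj_act.
rewrite /determinant rmorph_sum mulr_suml; apply: eq_big => [u|u _].
  by rewrite inE.
rewrite /T rmorphM rmorph_sign.
have -> : \prod_k x (act u k) = (-1) ^+ u * \prod_k x (g0 k).
  rewrite -(alternating_prod_perm anti_x).
  by apply: eq_bigr => k _; rewrite ffunE.
rewrite mulrA; congr (_ * _); rewrite commr_sign; congr (_ * K _).
by apply: eq_bigr => k _; rewrite mxE ffunE.
Qed.

End AlternatingExpansion.

(** * Truncated power series *)

(* Power series over [L] are handled through their truncations, as polynomials
   up to congruence modulo ['X^N]. *)
Definition eqXn (L : nzRingType) (N : nat) (u v : {poly L}) :=
  forall k, (k < N)%N -> u`_k = v`_k.

Lemma eqXn_trans (L : nzRingType) N (v u w : {poly L}) :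
  eqXn N u v -> eqXn N v w -> eqXn N u w.
Proof. by move=> uv vw k ltkN; rewrite uv ?vw. Qed.

Lemma eqXnM (L : nzRingType) N (u u' v v' : {poly L}) :
  eqXn N u u' -> eqXn N v v' -> eqXn N (u * v) (u' * v').
Proof.
move=> uu' vv' k lt_kN; rewrite !coefM; apply: eq_bigr => i _.
by rewrite uu' ?vv' // (leq_ltn_trans _ lt_kN) ?leq_subr // -ltnS.
Qed.

Lemma eqXn_sum (L : nzRingType) N I (r : seq I) (u v : I -> {poly L}) :
  (forall i, eqXn N (u i) (v i)) -> eqXn N (\sum_(i <- r) u i) (\sum_(i <- r) v i).
Proof. by move=> uv k ltkN; rewrite !coef_sum; apply: eq_bigr => i _; apply: uv. Qed.

Lemma eqXn_prod (L : nzRingType) N I (r : seq I) (u v : I -> {poly L}) :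
  (forall i, eqXn N (u i) (v i)) -> eqXn N (\prod_(i <- r) u i) (\prod_(i <- r) v i).
Proof.
move=> uv; elim: r => [|i r IHr]; first by rewrite !big_nil.
by rewrite !big_cons; apply: eqXnM.
Qed.

(** As [u] has constant coefficient 1, the k-th coefficient of [u * v] is that of [v] plus terms in
    earlier coefficients of [v]. *)
Lemma eqXn_cancel (L : nzRingType) N (u v w : {poly L}) :
  u`_0 = 1 -> eqXn N (u * v) (u * w) -> eqXn N v w.
Proof.
move=> u0 uvw k; elim/ltn_ind: k => k IHk ltkN.
have := uvw k ltkN; rewrite !coefM !big_ord_recl u0 subn0 !mul1r.
have -> : \sum_(i < k) u`_(lift ord0 i) * v`_(k - lift ord0 i)
        = \sum_(i < k) u`_(lift ord0 i) * w`_(k - lift ord0 i).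
  apply: eq_bigr => i _; congr (_ * _).
  have lt_k : (k - bump 0 i < k)%N by rewrite ltn_subrL /= (leq_ltn_trans (leq0n i)).
  exact: IHk lt_k (ltn_trans lt_k ltkN).
exact: addIr.
Qed.

Section AlgebraPolynomials.

Variables (A : comNzRingType) (L : algType A).

Local Notation K := (map_poly (in_alg L)).

Lemma coef_algM (a : {poly A}) (u : {poly L}) n :
  (K a * u)`_n = fps_scale (fun i => a`_i) (fun i => u`_i) n.
Proof.
by rewrite coefM; apply: eq_bigr => i _; rewrite coef_map /= mulr_algl.
Qed.

Lemma map_in_alg_central (a : {poly A}) (u : {poly L}) : K a * u = u * K a.
Proof.
apply/polyP => n; rewrite coefM coefMr; apply: eq_bigr => i _.
by rewrite !coef_map /= mulr_algl mulr_algr.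
Qed.

Lemma fps_scaleE N (a : fps A) (v : fps L) n : (n < N)%N ->
  fps_scale a v n = (K (\poly_(i < N) a i) * \poly_(i < N) v i)`_n.
Proof.
move=> lt_nN; rewrite coef_algM; apply: eq_bigr => i _; rewrite !coef_poly.
by rewrite (leq_ltn_trans (leq_subr _ _) lt_nN) (leq_trans (ltn_ord i) lt_nN).
Qed.

Lemma fps_scale_ext (a a' : fps A) (v v' : fps L) :
  a =1 a' -> v =1 v' -> fps_scale a v =1 fps_scale a' v'.
Proof. by move=> aa' vv' n; apply: eq_bigr => i _; rewrite aa' vv'. Qed.

Lemma fps_scale_invK (p : {poly A}) (v : fps L) : p`_0 = 1 ->
  fps_scale (fps_inv p) (fps_scale (fun i => p`_i) v) =1 v.
Proof.
(* Truncation at [N] keeps the coefficient of index [n] and reduces the claim to associativity of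
   the product of polynomials. *)
move=> p0 n; pose N := n.+1; have ltnN : (n < N)%N by [].
pose q := \poly_(i < N) fps_inv p i; pose V := \poly_(i < N) v i.
have scaleE i : (i < N)%N -> fps_scale (fun i => p`_i) v i = (K p * V)`_i.
  move=> lt_iN; rewrite coef_algM; apply: eq_bigr => j _.
  by rewrite coef_poly (leq_ltn_trans (leq_subr _ _) lt_iN).
have qp1 : eqXn N (K (q * p)) 1.
  move=> k ltkN; rewrite mulrC coef_map coefM coef1 /=.
  rewrite -scaler_nat -(fps_mul_inv p0); congr (_ *: _); apply: eq_bigr => i _.
  by rewrite coef_poly (leq_ltn_trans (leq_subr _ _) ltkN).
rewrite (fps_scaleE _ _ ltnN) -/q.
rewrite (@eqXnM _ N _ (K q) _ (K p * V)) // => [|i lt_iN]; last first.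
  by rewrite coef_poly lt_iN scaleE.
by rewrite mulrA -rmorphM (eqXnM qp1 (fun _ _ => erefl)) // mul1r coef_poly ltnN.
Qed.

End AlgebraPolynomials.

(** * The multiplicative extension of f *)

Section Reversal.

Variables (A : comNzRingType) (M : vectType A) (f : 'End(M)).

Lemma Epoly_mxE i j :
  (1%:M - 'X *: map_mx (@polyC A) (f2mx f)) i j = (i == j)%:R%:P + (- f2mx f i j) *: 'X.
Proof. by rewrite !mxE scaleNr -mul_polyC mulrC polyC_natr. Qed.

(** The matrices of t id - f and id - tf have the same entries up to exchanging the coefficients of
    1 and t, so [det_reversal] applies. *)
Lemma Epoly_rev k : (k <= dim M)%N -> (Epoly f)`_k = (-1) ^+ k * char_coef f k.
Proof.
move=> le_k; rewrite /char_coef signrMK; apply: det_reversal => // i j.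
exists (i == j)%:R, (- f2mx f i j); rewrite Epoly_mxE !mxE polyCN addrC.
by rewrite scaler_nat.
Qed.

Lemma size_Epoly : (size (Epoly f) <= (dim M).+1)%N.
Proof. by apply: size_det_linear => i j; rewrite Epoly_mxE size_linear_poly. Qed.

(** This identifies the U_i with the coefficients of E f(t), which turns the theorem into a bound on
    the degree of E f(t)(alpha). *)
Lemma UopE (L : algType A) (Fc : fps {linear L -> L}) i alpha :
  Uop f Fc i alpha = fps_scale (fun k => (Epoly f)`_k) (fun k => Fc k alpha) i.
Proof.
pose G k := (Epoly f)`_k *: Fc (i - k)%N alpha.
(* A common range for the two sums; the terms with k > dim M vanish by the degree of E. *)
pose m := maxn (dim M).+1 i.+1.
transitivity (\sum_(k < m | (k <= i)%N && (k < (dim M).+1)%N) G k).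
  rewrite -(big_ord_widen_cond m (fun k => k <= i)%N G) ?leq_maxl //.
  by apply: eq_bigr => k _; rewrite /G Epoly_rev // -ltnS.
rewrite /fps_scale -/G (big_ord_widen m G) ?leq_maxr //.
rewrite [RHS](bigID (fun k : 'I_m => (k < (dim M).+1)%N)) /=.
rewrite [X in _ + X]big1 ?addr0 // => k /andP[_]; rewrite -leqNgt => lt_k.
by rewrite /G nth_default ?scale0r // (leq_trans size_Epoly).
Qed.

End Reversal.

Section Extension.

Variables (A : comNzRingType) (M : vectType A) (f : 'End(M)).
Variables (L : algType A) (iota : {linear M -> L}) (Fc : fps {linear L -> L}).
Hypothesis sqr_iota : forall m, iota m * iota m = 0.
Hypothesis extF : ext_extension iota f Fc.

Local Notation n := (dim M).
Local Notation K := (map_poly (in_alg L)).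

Let B : 'M[{poly A}]_n := 1%:M - 'X *: map_mx (@polyC A) (f2mx f).
Let e (i : 'I_n) : M := r2v (delta_mx 0 i).
Let T N alpha : {poly L} := \poly_(k < N) Fc k alpha.

(** Polarisation of the vanishing of squares. *)
Lemma anticomm_iota m m' : iota m * iota m' = - (iota m' * iota m).
Proof.
have := sqr_iota (m + m'); rewrite linearD mulrDl !mulrDr !sqr_iota add0r addr0.
by move/eqP; rewrite addr_eq0 => /eqP.
Qed.

Lemma size_id_subX_entry i j : (size (B i j) <= 2)%N.
Proof. by rewrite Epoly_mxE size_linear_poly. Qed.

Lemma basis_expansion m : m = \sum_i v2r m 0 i *: e i.
Proof.
rewrite -[LHS]v2rK [v2r m in LHS]row_sum_delta linear_sum.
by apply: eq_bigr => i _; rewrite linearZ.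
Qed.

(** The induction starts from a single factor, since [ext_extension] prescribes f(t) on M and on
    products but not directly at 1. *)
Lemma trunc_prod N p (m : 'I_p.+1 -> M) :
  eqXn N (T N (\prod_k iota (m k))) (\prod_k T N (iota (m k))).
Proof.
elim: p m => [|p IHp] m; first by rewrite !big_ord_recl !big_ord0 !mulr1.
rewrite big_ord_recl [X in eqXn _ _ X]big_ord_recl.
apply: eqXn_trans (eqXnM (fun _ _ => erefl) (IHp _)) => k ltkN.
rewrite coef_poly ltkN extF.1 coefM; apply: eq_bigr => i _; rewrite !coef_poly.
by rewrite (leq_ltn_trans (leq_subr _ _) ltkN) (leq_trans (ltn_ord i) ltkN).
Qed.

Lemma trunc_iota N i :
  eqXn N (K (Epoly f) * T N (iota (e i)))
         (\sum_j K (\adj B i j) * (iota (e j))%:P).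
Proof.
pose v k := v2r (iter k f (e i)).
have vS k : v k.+1 = v k *m f2mx f.
  by rewrite /v iterS; move: (iter _ _ _) => w; rewrite unlock /= r2vK.
pose S : 'rV[{poly A}]_n := \row_j \poly_(k < N) v k 0 j.
(* The product with id - tf telescopes: only the constant term, the coordinates of [e i], remains
   below degree [N]. *)
have SB j : eqXn N ((S *m B) 0 j) (i == j)%:R.
  move=> k ltkN; rewrite mulmxBr mulmx1 -scalemxAr !mxE coefB coefXM coef_poly ltkN.
  case: k ltkN => [|k] ltkN; rewrite /= ?subr0.
    by rewrite /v /= r2vK mxE eqxx /= coefMn coef1 eq_sym.
  rewrite coefMn coef1 mul0rn vS mxE coef_sum.
  apply/eqP; rewrite subr_eq0; apply/eqP; apply: eq_bigr => l _.
  by rewrite !mxE coefMC coef_poly ltnW.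
have ES j : eqXn N (Epoly f * S 0 j) (\adj B i j).
  have -> : Epoly f * S 0 j = ((S *m B) *m \adj B) 0 j.
    by rewrite -mulmxA mul_mx_adj mul_mx_scalar [RHS]mxE.
  rewrite mxE; apply: (@eqXn_trans _ _ (\sum_l (i == l)%:R * \adj B l j)).
    by apply: eqXn_sum => l; apply: eqXnM (SB l) _.
  rewrite (bigD1 i) //= eqxx mul1r big1 ?addr0 // => l /negPf.
  by rewrite eq_sym => ->; rewrite mul0r.
have -> : T N (iota (e i)) = \sum_j K (S 0 j) * (iota (e j))%:P.
  apply/polyP => k; rewrite coef_poly coef_sum.
  transitivity (\sum_j (S 0 j)`_k *: iota (e j)); last first.
    by apply: eq_bigr => j _; rewrite coefMC coef_map /= mulr_algl.
  case: ifP => ltkN.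
    rewrite extF.2 [iter _ _ _]basis_expansion linear_sum; apply: eq_bigr => j _.
    by rewrite linearZ mxE coef_poly ltkN.
  by rewrite big1 // => j _; rewrite mxE coef_poly ltkN scale0r.
rewrite mulr_sumr; apply: eqXn_sum => j; rewrite mulrA -rmorphM.
by apply: eqXnM => // k ltkN; rewrite !coef_map ES.
Qed.

Lemma Uop_basis_prod p (s : 'I_p.+1 -> 'I_n) i : (n - p.+1 < i)%N ->
  Uop f Fc i (\prod_k iota (e (s k))) = 0.
Proof.
move=> lt_i; rewrite UopE; pose N := i.+1; set alpha := \prod_k _.
pose x j : {poly L} := (iota (e j))%:P.
have sqr_x j : x j * x j = 0 by rewrite -polyCM sqr_iota.
have anti_x j l : x j * x l = - (x l * x j) by rewrite -!polyCM anticomm_iota polyCN.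
have central := @map_in_alg_central A L.
pose C := rowsub s (\adj B).
have [gs expand] := @alternating_expansion _ _ K central _ _ x sqr_x anti_x C.
(* By the bound on minors of the adjugate, E times each term of the expansion is E^(p+1) times a
   polynomial of degree at most n - (p+1), hence less than i. [Z] is the sum of these
   polynomials. *)
have [Z Zi EZ] : exists2 Z : {poly L}, Z`_i = 0 &
    K (Epoly f) * \sum_(g <- gs) K (\det (colsub g C)) * \prod_k x (g k)
    = K (Epoly f ^+ p.+1) * Z.
  elim: gs {expand} => [|g gs [Z Zi EZ]].
    by exists 0; rewrite ?coef0 // big_nil !mulr0.
  have [Q sQ EQ] := @det_mxsub_adj_linear _ _ p.+1 B s g size_id_subX_entry.
  exists (K Q * \prod_k x (g k) + Z).
    rewrite coefD Zi addr0 /x -rmorph_prod coefMC coef_map /= nth_default ?scale0r ?mul0r //.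
    exact: leq_trans sQ lt_i.
  rewrite big_cons !mulrDr EZ !mulrA -!rmorphM mulrC /Epoly -/B -EQ.
  by congr (K (\det _ * _) * _ + _); apply/matrixP => a b; rewrite !mxE.
have E0 : (K (Epoly f ^+ p.+1))`_0 = 1.
  rewrite coef_map /= -horner_coef0 horner_exp horner_coef0 Epoly_coef0.
  by rewrite expr1n scale1r.
(* Both sides are multiplied by E^(p+1), which is cancellable; each of the p+1 wedge factors then
   absorbs one copy of E and becomes a row of the adjugate. *)
have key : eqXn N (K (Epoly f) * T N alpha) Z.
  apply: (eqXn_cancel E0).
  rewrite -EZ -expand mulrA -rmorphM mulrC rmorphM -mulrA.
  apply: eqXnM => //.
  apply: (@eqXn_trans _ _ (K (Epoly f ^+ p.+1) * \prod_k T N (iota (e (s k))))).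
    by apply: eqXnM => //; apply: trunc_prod.
  have -> : Epoly f ^+ p.+1 = \prod_(k < p.+1) Epoly f by rewrite prodr_const card_ord.
  rewrite -central_prod //; apply: eqXn_prod => k.
  have -> : \sum_j K (C k j) * x j = \sum_j K (\adj B (s k) j) * (iota (e j))%:P.
    by apply: eq_bigr => j _; rewrite mxE.
  exact: trunc_iota.
rewrite -Zi -key // coef_algM; apply: eq_bigr => k _.
by rewrite coef_poly ltnS leq_subr.
Qed.

Lemma Uop_sum I (r : seq I) i (a : I -> L) :
  Uop f Fc i (\sum_(j <- r) a j) = \sum_(j <- r) Uop f Fc i (a j).
Proof.
rewrite /Uop exchange_big; apply: eq_bigr => k _.
by rewrite linear_sum scaler_sumr.
Qed.

Lemma UopZ i c alpha : Uop f Fc i (c *: alpha) = c *: Uop f Fc i alpha.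
Proof.
rewrite /Uop scaler_sumr; apply: eq_bigr => k _.
by rewrite linearZ !scalerA mulrC.
Qed.

(** Multilinear expansion on the basis reduces this to [Uop_basis_prod], where repeated basis
    vectors are allowed. *)
Lemma Uop_ext_power p i alpha : (0 < p)%N -> (n - p < i)%N ->
  ext_power iota p alpha -> Uop f Fc i alpha = 0.
Proof.
case: p => // p _ lt_i [q [c [m ->]]]; rewrite Uop_sum big1 // => l _.
rewrite UopZ; suff -> : Uop f Fc i (\prod_k iota (m l k)) = 0 by rewrite scaler0.
have -> : \prod_k iota (m l k) = \prod_k \sum_j (v2r (m l k) 0 j *: iota (e j)).
  apply: eq_bigr => k _; rewrite {1}[m l k]basis_expansion linear_sum.
  by apply: eq_bigr => j _; rewrite linearZ.
rewrite bigA_distr_bigA Uop_sum big1 // => g _.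
by rewrite scaler_prod UopZ Uop_basis_prod ?scaler0.
Qed.

(** Under this hypothesis the numerator cut at [j] is the whole series E f(t)(alpha), and dividing
    by E gives back f(t)(alpha). *)
Lemma Uquotient_eq j alpha : (forall i, (j <= i)%N -> Uop f Fc i alpha = 0) ->
  (fun k => Fc k alpha) =1 Uquotient f Fc j alpha.
Proof.
move=> U0 k; rewrite /Uquotient.
rewrite (@fps_scale_ext _ _ _ (fps_inv (Epoly f)) _
  (fps_scale (fun i => (Epoly f)`_i) (fun i => Fc i alpha))) //; last first.
  by move=> i; rewrite -UopE; case: ltnP => // /U0.
by rewrite fps_scale_invK // Epoly_coef0.
Qed.

End Extension.

Theorem corollary1p2 (A : comNzRingType) (r : nat) (M : vectType A)
    (rankM : dim M = r) (f : 'End(M))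
    (L : algType A) (iota : {linear M -> L}) (extL : exterior_algebra iota)
    (F : fps {linear L -> L}) (extF : ext_extension iota f F) :
  (forall alpha : L, ext_positive iota alpha ->
     (fun k => F k alpha) =1 Uquotient f F r alpha) /\
  (forall j : nat, (1 <= j <= r)%N ->
   forall alpha : L, ext_power iota (r - j + 1) alpha ->
     (fun k => F k alpha) =1 Uquotient f F j alpha).
Proof.
have [sqr_iota _] := extL; split=> [alpha [a ext_a ->]|j /andP[j_gt0 le_jr] alpha ext_alpha].
  apply: Uquotient_eq => i le_ri; rewrite Uop_sum big_nat_cond big1 // => j.
  rewrite andbT => /andP[j_gt0 le_j]; apply: (Uop_ext_power sqr_iota extF j_gt0 _ (ext_a j)).
  (* In each degree j >= 1 the bound reads r - j < r <= i. *)
  by rewrite rankM in le_j *; rewrite (leq_trans _ le_ri) // ltn_subrL j_gt0 (leq_trans j_gt0).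
apply: Uquotient_eq => i le_ji.
apply: (Uop_ext_power sqr_iota extF _ _ ext_alpha); first by rewrite addn1.
(* Here r - (r - j + 1) = j - 1 < j <= i. *)
by rewrite rankM addn1 subnS subKn // (leq_trans _ le_ji) // prednK.
Qed.
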